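(* Let $X$ be a connected separable locally compact Hausdorff space with fewer than $\mathfrak c=|\mathbb R|$ non-cut points. Then: (i) $X$ embeds into a dendrite whose cut points are precisely the cut points of $X$; that is, there exist a dendrite $D$ and a homeomorphic embedding $e:X\to D$ such that the set of cut points of $D$ equals $\{e(x): x \text{ is a cut point of } X\}$; and (ii) the set of non-cut points of $X$ is a nowhere dense $G_\delta$-subset of $X$.
   Context: A point $x$ of a connected space $X$ is a cut point if $X\setminus\{x\}$ is disconnected; otherwise it is a non-cut point. Two points $a,b$ of a connected space $D$ are separated by a third point $c$ if $D\setminus\{c\}$ is the union of two disjoint open sets, one containing $a$ and the other containing $b$. A connected space is dendritic if every two (distinct) points are separated by some other point. A dendron is a dendritic compact Hausdorff space, and a dendrite is a metrizable dendron.
   Formalization: That the set of non-cut points is nowhere dense is asserted only when X has at least two points: in a one-point space the single point is a non-cut point and the set of non-cut points is the whole space, so the claim fails there. *)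

(* Defs.v *)
From mathcomp Require Import all_boot all_order all_algebra.
From mathcomp Require Import all_classical all_reals all_analysis borel_hierarchy.

Set Implicit Arguments.
Unset Strict Implicit.
Unset Printing Implicit Defensive.

Local Open Scope classical_set_scope.
Local Open Scope card_scope.

Definition card_lt (T U : Type) (A : set T) (B : set U) : Prop :=
  (A #<= B) /\ ~ (B #<= A).

Definition separable_space (T : topologicalType) : Prop :=
  exists2 S : set T, countable S & dense S.

Definition nowhere_dense (T : topologicalType) (A : set T) : Prop :=
  interior (closure A) = set0.

Definition topological_embedding (S T : topologicalType) (f : S -> T) : Prop :=
  [/\ injective f, continuous f &
      forall U : set S, open U ->
        exists2 V : set T, open V & f @` U = range f `&` V].

Definition homeomorphism (S T : topologicalType) (f : S -> T) : Prop :=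
  topological_embedding f /\ range f = [set: T].

Definition metrizable (R : realType) (T : topologicalType) : Prop :=
  exists (M : metricType R) (f : T -> M), homeomorphism f.

Definition cut_point (T : topologicalType) (x : T) : Prop :=
  ~ connected (~` [set x]).

Definition cut_points (T : topologicalType) : set T :=
  [set x | cut_point x].

Arguments cut_points T : clear implicits.

Definition noncut_points (T : topologicalType) : set T :=
  [set x | ~ cut_point x].

Arguments noncut_points T : clear implicits.

(* Since [c] lies in neither [U] nor [V], it differs from both [a] and [b]. *)
Definition separates (T : topologicalType) (c a b : T) : Prop :=
  exists U V : set T,
    [/\ open U /\ open V, U a, V b, U `&` V = set0 & U `|` V = ~` [set c]].

Definition dendritic (T : topologicalType) : Prop :=
  connected [set: T] /\
  forall a b : T, a <> b -> exists c : T, separates c a b.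

Definition dendron (T : topologicalType) : Prop :=
  [/\ dendritic T, compact [set: T] & hausdorff_space T].

Definition dendrite (R : realType) (T : topologicalType) : Prop :=
  dendron T /\ metrizable R T.

(* Main.v *)
(**
If the complement of c is a union of disjoint open sets U and V, then
collapsing V to c retracts the connected space X onto U + {c}; hence U + {c} is
connected, and it meets every connected set in a connected set.

X is dendritic: suppose that no point separates p from q, and let M be the
intersection of the sets U + {c} that contain p and q. A bump function f with
f p = 0 and f q = 1 takes every value of ]0, 1[ on M, by compactness of its
level sets. A cut point z in M has M - {z} on one of its sides, and the opposite
sides for distinct z are disjoint open sets, so that separability leaves only
countably many such z. Hence M contains continuum many non-cut points.

In a dendritic X, countably many pairs of sides (U_k, V_k) at points c_k suffice
to separate all points, and finite intersections of the U_k form a base. With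
bump functions that vanish at c_k, equal 1 off a compact set, and carry the
sign - on U_k and + on V_k, X embeds into a Hilbert cube. All coordinates of a
point of the closure D outside X are 1 or -1, that is, they tell only on which
side of each c_k the point lies; so cuts of X extend to cuts of D.

A point y is a non-cut point iff every two points of a countable dense set that
differ from y lie in a common V_k with y in U_k, which is a G_delta condition.
If the non-cut points were dense in a nonempty open set, a Cantor scheme in that
set would yield continuum many of them.
*)

Require Import Defs.
From HB Require Import structures.
From mathcomp Require Import all_boot all_order all_algebra.
From mathcomp Require Import all_classical all_reals all_analysis borel_hierarchy.

Set Implicit Arguments.
Unset Strict Implicit.
Unset Printing Implicit Defensive.

Import Order.TTheory GRing.Theory Num.Theory.
Import numFieldNormedType.Exports.

Local Open Scope classical_set_scope.

(** * Compactness and connectedness *)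

Lemma compact_ind (T : topologicalType) (K : set T) (P : set T -> Prop) :
  compact K -> P set0 -> (forall A B, P A -> P B -> P (A `|` B)) ->
  (forall A B, A `<=` B -> P B -> P A) ->
  (forall x, K x -> exists2 U, nbhs x U & P U) -> P K.
Proof.
move=> cK P0 PU PS Ploc; apply: contrapT => nPK.
(* If [P K] fails, these sets form a proper filter containing [K], and a cluster point of it in [K]
   contradicts [Ploc]. *)
pose F := [set A : set T | P (K `\` A)].
have FF : ProperFilter F.
  split; first by rewrite /F /= setD0.
  split.
  - by rewrite /F /= setDT.
  - by move=> A B PA PB; rewrite /F /= setDIr; apply: PU.
  - by move=> A B AB; apply: PS; exact: setDS.
have [|x [Kx clx]] := cK F FF; first by rewrite /F /= setDv.
have [U Ux PUU] := Ploc _ Kx.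
have [|y [nUy Uy]] := clx (~` U) U _ Ux; last by [].
by rewrite /F /= setDE setCK; apply: PS PUU => z [].
Qed.

(** [U] and the complement of [V] have the same trace on [C], so this trace is clopen in [C].
    Disjointness and covering are asked on [C] only. *)
Lemma connected_subset_side (T : topologicalType) (C U V : set T) (z : T) :
  connected C -> open U -> open V -> (forall x, C x -> U x -> ~ V x) ->
  (forall x, C x -> U x \/ V x) -> C z -> U z -> C `<=` U.
Proof.
move=> cC oU oV UV CUV Cz Uz.
have <- : C `&` U = C; last by move=> x [].
apply: cC; [by exists z | by exists U |].
exists (~` V); first exact: open_closedC.
apply/seteqP; split=> x [Cx ?]; split=> //; first exact: UV.
by case: (CUV _ Cx).
Qed.

(** Either side may be empty, so this alone does not make [c] a cut point. *)
Definition cut_sides (T : topologicalType) (c : T) (U V : set T) :=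
  [/\ open U, open V, (forall z, U z -> ~ V z) &
      forall z, z <> c <-> U z \/ V z].

(** * Sides of a cut point *)

Section CutSides.
Context {T : topologicalType}.
Implicit Types (c z : T) (C U V : set T).

Lemma cut_sidesC c U V : cut_sides c U V -> cut_sides c V U.
Proof.
move=> [oU oV UV cUV]; split=> // [z Vz Uz|z]; first exact: UV Uz Vz.
by rewrite cUV or_comm.
Qed.

Lemma cut_sidesNl c U V : cut_sides c U V -> ~ U c.
Proof. by move=> [_ _ _ /(_ c) h] Uc; case: h => _ /(_ (or_introl Uc)). Qed.

Lemma cut_sidesNr c U V : cut_sides c U V -> ~ V c.
Proof. by move=> /cut_sidesC /cut_sidesNl. Qed.

Lemma cut_sidesE c U V z : cut_sides c U V -> ~ V z -> z <> c -> U z.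
Proof. by move=> [_ _ _ cUV] nVz /cUV[]. Qed.

Lemma separatesP c a b :
  separates c a b <-> exists U V, [/\ cut_sides c U V, U a & V b].
Proof.
split=> [[U [V [[oU oV] Ua Vb UV0 UVc]]]|[U [V [[oU oV UV UVc] Ua Vb]]]].
  exists U, V; split=> //; split=> // z.
    by move=> Uz Vz; have : (U `&` V) z by []; rewrite UV0.
  by split=> [zc|]; [have : (~` [set c]) z by []; rewrite -UVc|
     move=> h; have : (U `|` V) z by []; rewrite UVc].
exists U, V; split=> //.
  by rewrite -subset0 => z [/UV].
by apply/seteqP; split=> z /UVc.
Qed.

Lemma connected_side c U V C z :
  cut_sides c U V -> connected C -> ~ C c -> C z -> U z -> C `<=` U.
Proof.
move=> [oU oV UV cUV] cC nCc Cz Uz.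
apply: (connected_subset_side cC oU oV _ _ Cz Uz) => x Cx; first exact: UV.
by apply/cUV => xc; apply: nCc; rewrite -xc.
Qed.

Lemma cut_pointP c : hausdorff_space T -> cut_point c <->
  exists U V, [/\ cut_sides c U V, U !=set0 & V !=set0].
Proof.
move=> hT; have clc : closed [set c].
  exact/accessible_closed_set1/hausdorff_accessible.
split=> [ncon|[U [V [cUV [u Uu] [v Vv]]]] con]; last first.
  have [_ _ UV cE] := cUV.
  have sub : ~` [set c] `<=` U.
    by apply: (connected_side cUV con _ _ Uu); [apply|apply/cE; left].
  by apply: (UV v); [apply/sub/cE; right|].
apply: contrapT => nex; apply: ncon => B B0 [C oC BC] [D cD BD].
apply: contrapT => BN; apply: nex.
(* [B] is clopen in the complement of [c]; since [[set c]] is closed, [B] and the rest of that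
   complement are open in the whole space. *)
exists B, (~` [set c] `&` ~` D); split=> //; last first.
  apply: contrapT => /forallNP h; apply: BN; rewrite BD.
  by apply/setIidPl => z zc; have /not_andP[//|/contrapT] := h z.
split.
- by rewrite BC; apply: openI => //; exact: closed_openC.
- by apply: openI; exact: closed_openC.
- by move=> z + [_]; rewrite BD => -[].
- move=> z; split=> [zc|].
    by have [Dz|nDz] := pselect (D z); [left; rewrite BD|right].
  by move=> [|[]//]; rewrite BD => -[].
Qed.

(** A substitute for convexity: unlike connectedness, it is stable under intersection. *)
Definition connected_trace C :=
  forall A : set T, connected A -> connected (A `&` C).

Lemma connected_traceI A B :
  connected_trace A -> connected_trace B -> connected_trace (A `&` B).
Proof. by move=> cA cB C cC; rewrite setIA; apply: cB; exact: cA. Qed.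

Lemma side_convex c U V : cut_sides c U V -> connected_trace (~` V).
Proof.
move=> cUV C cC; have [oU oV UV cE] := cUV.
have [Cc|nCc] := pselect (C c); last first.
  have [[z [Cz Uz]]|/forallNP CU] := pselect (C `&` U !=set0).
    have CU := connected_side cUV cC nCc Cz Uz.
    suff -> : C `&` ~` V = C by [].
    by apply/setIidPl => x /CU; exact: UV.
  suff -> : C `&` ~` V = set0 by exact: connected0.
  rewrite -subset0 => x [Cx nVx]; apply: (CU x); split=> //.
  by apply: (cut_sidesE cUV) => // xc; apply: nCc; rewrite -xc.
(* the retraction that collapses V to c *)
pose r z := if pselect (V z) then c else z.
have -> : C `&` ~` V = r @` C.
  apply/seteqP; split=> [x [Cx nVx]|_ [x Cx <-]]; rewrite /r.
    by exists x => //; case: pselect.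
  by case: pselect => //= _; split=> //; exact: (cut_sidesNr cUV).
apply: connected_continuous_connected => //.
apply: continuous_subspaceT; apply/continuousP => O oO.
have [Oc|nOc] := pselect (O c).
  suff -> : r @^-1` O = O `|` V by exact: openU.
  apply/seteqP; split=> x; rewrite /r /=; case: pselect => //=.
  - by right.
  - by left.
  - by move=> ? [].
suff -> : r @^-1` O = O `&` U by exact: openI.
apply/seteqP; split=> x; rewrite /r /=; case: pselect => //=.
- move=> nVx Ox; split=> //; apply: (cut_sidesE cUV) => // xc.
  by apply: nOc; rewrite -xc.
- by move=> Vx [_ /UV].
- by move=> ? [].
Qed.

Lemma side_connected c U V :
  connected [set: T] -> cut_sides c U V -> connected (~` V).
Proof. by move=> cT /side_convex/(_ _ cT); rewrite setTI. Qed.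

(** The complement of [V'] is connected, misses [c], and contains the point [c'] of [U]. *)
Lemma side_sub c U V c' U' V' : connected [set: T] ->
  cut_sides c U V -> cut_sides c' U' V' -> V' c -> U c' -> ~` V' `<=` U.
Proof.
move=> cT cUV cUV' V'c Uc'.
apply: (connected_side cUV (side_connected cT cUV') _ _ Uc') => //=.
exact: cut_sidesNr cUV'.
Qed.

End CutSides.

Local Open Scope card_scope.
Local Open Scope ring_scope.

(** * Cardinalities *)

Lemma card_le_inj (T U : Type) (A : set T) (B : set U) (f : T -> U) :
  (forall x, A x -> B (f x)) ->
  (forall x y, A x -> A y -> f x = f y -> x = y) -> A #<= B.
Proof.
move=> AB finj; suff cAfA : A #<= f @` A.
  by apply: (card_le_trans cAfA); apply: subset_card_le => _ [x /AB ? <-].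
have := @inj_card_eq _ _ A f; rewrite card_eq_sym card_eq_le.
by case/(_ _)/andP => // x y /set_mem ? /set_mem ?; exact: finj.
Qed.

(** A real is coded by its Dedekind cut, read along the enumeration of the rationals. *)
Lemma card_real_le_bool_seq (R : realType) : [set: R] #<= [set: nat -> bool].
Proof.
pose f (x : R) n := if unpickle n is Some q then (ratr q : R) < x else false.
apply: (@card_le_inj _ _ _ _ f) => // x y _ _ fxy.
have {}fxy q : ((ratr q : R) < x) = (ratr q < y).
  by move/(congr1 (fun g => g (pickle q))): fxy; rewrite /f pickleK.
apply/eqP; rewrite eq_le; apply/andP; split; rewrite leNgt; apply/negP.
  move=> /rat_in_itvoo[q]; rewrite in_itv /= fxy => /andP[/lt_trans h /h].
  by rewrite ltxx.
move=> /rat_in_itvoo[q]; rewrite in_itv /= -fxy => /andP[/lt_trans h /h].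
by rewrite ltxx.
Qed.

Lemma locally_compact_shrink (T : topologicalType) (O : set T) (x : T) :
  locally_compact [set: T] -> hausdorff_space T -> open O -> O x ->
  exists V, [/\ open V, V x, compact (closure V) & closure V `<=` O].
Proof.
move=> lT hT oO Ox; have [K] := lT x I; rewrite withinET => Kx [cK clK].
have [|A Ax AO] := compact_regular hT cK Kx (t := O).
  exact: open_nbhs_nbhs.
have VK : closure (A `&` K)° `<=` K.
  have /closure_id {2}-> := clK; apply: closureS.
  by move=> z /interior_subset[].
exists (A `&` K)°; split.
- exact: open_interior.
- by apply: filterI.
- exact: (subclosed_compact (@closed_closure _ _) cK VK).
- apply: subset_trans AO; apply: closureS.
  by move=> z /interior_subset[].
Qed.

(** A branching Baire argument: inside each open set of level n, intersected with [G n], choose two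
    disjoint relatively compact open sets. Every binary sequence then selects a decreasing chain
    whose closures share a point. *)
Lemma cantor_scheme (T : topologicalType) (W : set T) (G : nat -> set T) :
  locally_compact [set: T] -> hausdorff_space T -> open W -> W !=set0 ->
  (forall n, open (G n)) ->
  (forall O, open O -> O !=set0 -> O `<=` W ->
     exists x y, [/\ O x, O y & x <> y]) ->
  (forall n O, open O -> O !=set0 -> O `<=` W -> O `&` G n !=set0) ->
  [set: nat -> bool] #<= W `&` \bigcap_n G n.
Proof.
move=> lT hT oW W0 oG perf dG.
pose good (O : set T) := [/\ open O, O !=set0 & O `<=` W].
have split_ex (On : set T * nat) : exists Q : bool -> set T, good On.1 ->
    [/\ forall b, good (Q b), Q false `&` Q true = set0,
        forall b, compact (closure (Q b)) &
        forall b, closure (Q b) `<=` On.1 `&` G On.2].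
  case: On => O n /=; have [[oO O0 OW]|] := pselect (good O); last first.
    (* An arbitrary value: the scheme visits good sets only. *)
    by move=> ng; exists (fun=> set0).
  have oOG : open (O `&` G n) by exact: openI.
  have OGW : O `&` G n `<=` W by move=> z [/OW].
  have [x [y [OGx OGy xy]]] := perf _ oOG (dG n _ oO O0 OW) OGW.
  have := hT; rewrite open_hausdorff => /(_ x y)[]; first exact/eqP.
  move=> [A B] /= [/set_mem Ax /set_mem By] [oA oB /eqP AB0].
  have [V0 [oV0 V0x cV0 V0s]] :=
    locally_compact_shrink lT hT (openI oOG oA) (conj OGx Ax).
  have [V1 [oV1 V1y cV1 V1s]] :=
    locally_compact_shrink lT hT (openI oOG oB) (conj OGy By).
  have V0s' := subset_trans (@subset_closure _ V0) V0s.
  have V1s' := subset_trans (@subset_closure _ V1) V1s.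
  exists (fun b => if b then V1 else V0) => _; split.
  - case; split=> //; [by exists y| |by exists x|].
      by move=> z /V1s'[/OGW].
    by move=> z /V0s'[/OGW].
  - rewrite -subset0 => z [/V0s'[_ Az] /V1s'[_ Bz]].
    by rewrite -AB0.
  - by case.
  - by case=> z; [move=> /V1s[]|move=> /V0s[]].
pose Q O n := projT1 (cid (split_ex (O, n))).
have QP O n : good O ->
    [/\ forall b, good (Q O n b), Q O n false `&` Q O n true = set0,
        forall b, compact (closure (Q O n b)) &
        forall b, closure (Q O n b) `<=` O `&` G n].
  exact: (projT2 (cid (split_ex (O, n)))).
pose C (a : nat -> bool) := fix C n := if n is m.+1 then Q (C m) m (a m) else W.
have Cgood a n : good (C a n).
  by elim: n => [|m ih] /=; [split | have [] := QP _ m ih].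
have Ccl a n : closure (C a n.+1) `<=` C a n `&` G n.
  by have [_ _ _ +] := QP _ n (Cgood a n); exact.
have Cmono a m n : (m <= n)%N -> C a n `<=` C a m.
  elim: n => [|n ih]; first by rewrite leqn0 => /eqP->.
  rewrite leq_eqVlt ltnS => /orP[/eqP->//|/ih h].
  by apply: subset_trans h => z /subset_closure/Ccl[].
have pt a : exists x, forall n, closure (C a n) x.
  pose F := filter_from [set: nat] (C a).
  have FF : ProperFilter F.
    apply: filter_from_proper; last by move=> n _; have [] := Cgood a n.
    apply: filter_from_filter; first by exists 0%N.
    move=> m n _ _; exists (maxn m n) => // z Cz; split.
      by apply: Cmono Cz; exact: leq_maxl.
    by apply: Cmono Cz; exact: leq_maxr.
  (* The closure of [W] need not be compact, so compactness is taken from level 1 on. *)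
  have cC1 : compact (closure (C a 1%N)).
    by have [_ _ + _] := QP _ 0%N (Cgood a 0%N); exact.
  have [|x [_ clx]] := cC1 F FF.
    by exists 1%N => //; exact: subset_closure.
  by exists x => n B Bx; apply: clx => //; exists n.
pose p a := projT1 (cid (pt a)).
have pP a n : (C a n `&` G n) (p a).
  by apply: Ccl; exact: (projT2 (cid (pt a))).
apply: (@card_le_inj _ _ _ _ p) => [a _|a b _ _ pab].
  by split=> [|n _]; [have [] := pP a 0%N|have [] := pP a n].
(* The two children of a set are disjoint, so a common point of both chains determines the branch
   taken. *)
have CE n : C a n = C b n -> a n = b n.
  move=> Cab; have [+ _] := pP a n.+1; have [+ _] := pP b n.+1.
  have [_ Q0 _ _] := QP _ n (Cgood b n).
  rewrite /= -/(C a) -/(C b) Cab pab; move: Q0; rewrite -subset0.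
  by case: (a n); case: (b n) => //= Q0 h1 h2; case: (Q0 (p b)).
suff Cab n : C a n = C b n by apply/funext => n; exact/CE/Cab.
by elim: n => //= n ih; rewrite (CE _ ih) -/(C a) ih.
Qed.

Lemma card_bool_seq_itv (R : realType) (P : set R) :
  countable P -> [set: nat -> bool] #<= `]0 : R, 1 : R[%classic `\` P.
Proof.
move=> /countable_injP[f finj].
have oI : open `]0 : R, 1 : R[%classic by exact: itv_open.
(* Since [f] is injective on [P], each [G n] omits at most one point, so it is open and dense. *)
pose G n := ~` [set x | P x /\ f x = n].
have Gsub n x y : ~ G n x -> ~ G n y -> x = y.
  rewrite /G /= => /contrapT[Px fx] /contrapT[Py fy].
  by apply: finj; rewrite ?inE // fx fy.
have perf (O : set R) : open O -> O !=set0 -> O `<=` `]0 : R, 1 : R[%classic ->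
     exists x y, [/\ O x, O y & x <> y].
  move=> oO [x Ox] _.
  have /nbhs_ballP[e /= e0 xO] : nbhs x O by exact: open_nbhs_nbhs.
  exists x, (x + e / 2); split=> //.
    apply: xO; rewrite /ball /= opprD addrA subrr sub0r normrN gtr0_norm.
      by rewrite ltr_pdivrMr // ltr_pMr // ltr1n.
    by rewrite divr_gt0.
  by apply/eqP; rewrite lt_eqF // ltrDl divr_gt0.
apply: card_le_trans (cantor_scheme (@locally_compactR R) _ oI _ _ perf _) _.
- exact: Rhausdorff.
- exists (1 / 2) => /=.
  by rewrite in_itv /= divr_gt0 //= ltr_pdivrMr // mul1r ltr1n.
- instantiate (1 := G) => n; rewrite openC.
  have [[x [Px fx]]|nex] := pselect (exists x, P x /\ f x = n).
    rewrite (_ : [set _ | _] = [set x]); last first.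
      by apply/seteqP; split=> y /=; [move=> [Py fy]; apply: (Gsub n); exact|
        move=> ->].
    exact/accessible_closed_set1/hausdorff_accessible/Rhausdorff.
  rewrite (_ : [set _ | _] = set0); first exact: closed0.
  by rewrite -subset0 => y h; apply: nex; exists y.
- move=> n O oO O0 OI; have [x [y [Ox Oy xy]]] := perf O oO O0 OI.
  have [Gx|nGx] := pselect (G n x); first by exists x.
  have [Gy|nGy] := pselect (G n y); first by exists y.
  by case: xy; apply: (Gsub n).
- by apply: subset_card_le => x [Ix GI]; split=> // Px; apply: (GI (f x)).
Qed.

(** * Few non-cut points *)

Lemma locally_compact_bump (R : realType) (X : topologicalType) (x : X)
    (W : set X) :
  locally_compact [set: X] -> hausdorff_space X -> open W -> W x ->
  exists f : X -> R, [/\ continuous f, (forall z, 0 <= f z <= 1), f x = 0 &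
    forall z, ~ W z -> f z = 1].
Proof.
move=> lX hX oW Wx.
have /(uniform_separatorP (R := R))[f [cf f01 fx fW]] :
    uniform_separator [set x] (~` W).
  apply: (@locally_compact_completely_regular _ R) => //.
  exact: open_closedC.
exists f; split=> // [z||z nWz].
- by have := f01 (f z); rewrite /= in_itv /=; apply; exists z.
- by apply: fx; exists x.
- by apply: fW; exists z.
Qed.

Lemma few_noncut_dendritic (R : realType) (X : topologicalType) :
  connected [set: X] -> separable_space X -> locally_compact [set: X] ->
  hausdorff_space X -> ~ ([set: R] #<= noncut_points X) -> dendritic X.
Proof.
move=> cX [S cS dS] lX hX few; split=> // p q pq.
apply: contrapT => /forallNP nsep.
have [V [oV Vp cV Vq]] : exists V, [/\ open V, V p, compact (closure V) &
    closure V `<=` ~` [set q]].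
  apply: locally_compact_shrink => //; apply: closed_openC.
  exact/accessible_closed_set1/hausdorff_accessible.
have [f [cf f01 fp fV]] := @locally_compact_bump R X p V lX hX oV Vp.
have fq : f q = 1 by apply: fV => /(@subset_closure _ V) /Vq; exact.
(* The pair [A], [B] is ordered, so [M] takes both sides of each cut into account. *)
pose M z := forall c A B, cut_sides c A B -> ~ B p -> ~ B q -> ~ B z.
have attained t : 0 < t < 1 -> exists2 z, M z & f z = t.
  move=> /andP[t0 t1]; apply: contrapT => /exists2P nt.
  (* This is the whole level set, as [f] is 1 off [V]. If it missed [M], finitely many complements
     of sides would suffice to miss it; but their intersection [A] is connected and joins [p] to
     [q], so [f] takes the value [t] on it. *)
  pose K := closure V `&` f @^-1` [set t].
  have cK : compact K.
    apply: compact_closedI => //; apply: preimage_closed => [? _|]; first exact: cf.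
    exact/accessible_closed_set1/hausdorff_accessible/Rhausdorff.
  have [A [cvA Ap Aq AK]] :
      exists A, [/\ connected_trace A, A p, A q & forall z, K z -> ~ A z].
    apply: (compact_ind (P := fun B =>
      exists A, [/\ connected_trace A, A p, A q & forall z, B z -> ~ A z]) cK).
    - by exists setT; split=> // C; rewrite setIT.
    - move=> B1 B2 [A1 [c1 p1 q1 h1]] [A2 [c2 p2 q2 h2]].
      exists (A1 `&` A2); split=> //; first exact: connected_traceI.
      by move=> z [/h1|/h2] + [].
    - move=> B1 B2 B12 [A [? ? ? h]]; exists A; split=> // z /B12; exact: h.
    - move=> x [_ fx]; have nMx : ~ M x by move=> Mx; apply: nt; exists x.
      move/existsNP: nMx => [c /existsNP[A /existsNP[B]]].
      move=> /not_implyP[cAB /not_implyP[Bp /not_implyP[Bq /contrapT Bx]]].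
      have [_ oB _ _] := cAB.
      exists B; first exact: open_nbhs_nbhs.
      exists (~` B); split=> // [|z Bz]; first exact: side_convex cAB.
      by apply.
  have cfA : connected (f @` A).
    apply: connected_continuous_connected; last exact: continuous_subspaceT.
    by have := cvA _ cX; rewrite setTI.
  have [z Az fz] : (f @` A) t.
    have /connected_intervalP := cfA; apply; [exists p|exists q|] => //.
    by rewrite fp fq !ltW.
  apply: (AK z) => //; split=> //; apply: subset_closure.
  by apply: contrapT => /fV; rewrite fz => t1E; rewrite t1E ltxx in t1.
have sides z : M z -> cut_point z -> exists U B, [/\ cut_sides z U B,
    B !=set0 & forall y, M y -> y <> z -> U y].
  move=> Mz /(cut_pointP _ hX)[U [B [cUB U0 B0]]].
  have [_ _ UB _] := cUB.
  have sep a b : U a -> B b -> separates z a b.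
    by move=> Ua Bb; apply/separatesP; exists U, B.
  have sep' a b : B a -> U b -> separates z a b.
    move=> Ba Ub; apply/separatesP; exists B, U.
    by split=> //; exact: cut_sidesC.
  have [[Bp Bq]|nB] := pselect (~ B p /\ ~ B q).
    exists U, B; split=> // y My yz.
    by apply: (cut_sidesE cUB) => //; exact: My cUB Bp Bq.
  (* Here [p] or [q] lies in [B]; as [z] does not separate them, neither lies in [U], and the sides
     swap roles. *)
  exists B, U; split; [exact: cut_sidesC | by [] |].
  have [Up Uq] : ~ U p /\ ~ U q.
    split=> [Up|Uq].
      apply: nB; split; first exact: UB.
      by move=> Bq; apply: (nsep z); exact: sep.
    apply: nB; split; last exact: UB.
    by move=> Bp; apply: (nsep z); exact: sep'.
  move=> y My yz; apply: (cut_sidesE (cut_sidesC cUB)) => //.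
  exact: (My _ _ _ (cut_sidesC cUB)).
(* M misses one side B of each of its cut points z, and for distinct z these
   sides are disjoint. *)
have cMcut : countable (M `&` cut_points X).
  have ex z : exists s, (M `&` cut_points X) z -> exists U B,
      [/\ cut_sides z U B, B s, S s & forall y, M y -> y <> z -> U y].
    have [[Mz zc]|nz] := pselect ((M `&` cut_points X) z); last by exists z.
    have [U [B [cUB B0 MU]]] := sides z Mz zc.
    have [_ oB _ _] := cUB; have [s [Bs Ss]] := dS _ B0 oB.
    by exists s => _; exists U, B.
  pose s z := projT1 (cid (ex z)).
  have sP z := projT2 (cid (ex z)).
  apply: card_le_trans cS; apply: (@card_le_inj _ _ _ _ s).
    by move=> z /sP[U [B []]].
  move=> y z Hy Hz syz; apply: contrapT => yz.
  have [U [B [cUB Bs _ MU]]] := sP y Hy.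
  have [U' [B' [cUB' Bs' _ MU']]] := sP z Hz.
  have Uz : U z by apply: MU => [|/esym//]; case: Hz.
  have Uy : U' y by apply: MU' => //; case: Hy.
  have := side_sub cX cUB (cut_sidesC cUB') Uy Uz.
  move=> /(_ (s y)); have [_ _ UB' _] := cUB'; have [_ _ UB _] := cUB.
  case/(_ _)/UB; last by [].
  by move=> /= /UB'; apply; rewrite -/(s z) syz.
apply: few; apply: card_le_trans (@card_real_le_bool_seq R) _.
(* A value in ]0, 1[ that no cut point of [M] attains is attained at a non-cut point. *)
have cf' : countable (f @` (M `&` cut_points X)).
  exact: card_le_trans (card_image_le _ _) cMcut.
apply: card_le_trans (card_bool_seq_itv cf') _.
apply: card_le_trans (card_image_le f _).
apply: subset_card_le => t [/=]; rewrite in_itv /= => t01 nft.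
have [z Mz fz] := attained t t01.
by exists z => // zc; apply: nft; exists z.
Qed.

(** * Countably many sides *)

Lemma countable_enum (T : Type) (S : set T) :
  countable S -> S !=set0 ->
  exists g : nat -> T,
    (forall n, S (g n)) /\ forall s, S s -> exists n, g n = s.
Proof.
move=> /countable_injP[f finj] [s0 Ss0].
have ex n : exists s, S s /\ forall s', S s' -> f s' = n -> s' = s.
  have [[s [Ss fs]]|nex] := pselect (exists s, S s /\ f s = n).
    exists s; split=> // s' Ss' fs'.
    by apply: finj; rewrite ?inE // fs'.
  by exists s0; split=> // s' Ss' fs'; case: nex; exists s'.
exists (fun n => projT1 (cid (ex n))); split=> [n|s Ss].
  by case: (projT2 (cid (ex n))).
by exists (f s); case: (projT2 (cid (ex (f s)))) => _ /(_ s Ss erefl).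
Qed.

(** A neighbourhood of [c] that misses [U] would disconnect the complement of [V], which is [U]
    together with [c]. *)
Lemma side_adherent (X : topologicalType) (c p : X) (U V W : set X) :
  connected [set: X] -> cut_sides c U V -> U p -> open W -> W c ->
  U `&` W !=set0.
Proof.
move=> cX cUV Up oW Wc; apply: contrapT => /forallNP UW.
have [oU _ UV cE] := cUV.
have : ~` V `<=` U.
  apply: (connected_subset_side (side_connected cX cUV) oU oW _ _ _ Up).
  - by move=> x _ Ux Wx; apply: (UW x).
  - move=> x nVx; have [->|xc] := pselect (x = c); first by right.
    by left; apply: (cut_sidesE cUV).
  - exact: UV.
by move=> /(_ c (cut_sidesNr cUV)); exact: cut_sidesNl cUV.
Qed.

Section CountableSides.
Context {X : topologicalType}.
Context (X_connected : connected [set: X]) (X_dendritic : dendritic X).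

Let dendritic_sides (p q : X) : p <> q ->
  exists c U V, [/\ cut_sides c U V, U p & V q].
Proof.
move=> pq; have [_ /(_ _ _ pq)[c /separatesP[U [V UV]]]] := X_dendritic.
by exists c, U, V.
Qed.

(* The four points s, z, w, t pin down the position of the cut: any separation
   of s, z from w, t has to cut strictly between p and q. *)
Let pinned_cut (S : set X) (p q : X) : dense S -> p <> q ->
  exists s z w t, [/\ S s, S z, S w & S t] /\
    (exists c U V, [/\ cut_sides c U V, U s, U z, V w & V t]) /\
    forall c U V, cut_sides c U V -> U s -> U z -> V w -> V t -> U p /\ V q.
Proof.
move=> dS pq.
have neq (c : X) A B y : cut_sides c A B -> A y -> y <> c.
  by move=> cAB Ay; case: cAB => _ _ _ /(_ y) -[_]; apply; left.
have neq' (c : X) A B y : cut_sides c A B -> B y -> c <> y.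
  by move=> cAB By; apply: nesym; exact: neq (cut_sidesC cAB) By.
(* Five cuts between [p] and [q], in the order [x'], [x], [m], [y], [y']. *)
have [m [Um [Vm [mS Ump Vmq]]]] := dendritic_sides pq.
have [x [Ux [Vx [xS Uxp Vxm]]]] := dendritic_sides (neq _ _ _ _ mS Ump).
have [x' [Ux' [Vx' [xS' Ux'p Vx'x]]]] := dendritic_sides (neq _ _ _ _ xS Uxp).
have [y [Uy [Vy [yS Uym Vyq]]]] := dendritic_sides (neq' _ _ _ _ mS Vmq).
have [y' [Uy' [Vy' [yS' Uy'y Vy'q]]]] := dendritic_sides (neq' _ _ _ _ yS Vyq).
have conn (c : X) U V : cut_sides c U V -> connected (~` V).
  by move=> cUV; exact: side_connected X_connected cUV.
have UnV c U V z : @cut_sides X c U V -> U z -> ~ V z.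
  by case=> _ _ + _; exact.
have VnU c U V z : @cut_sides X c U V -> V z -> ~ U z.
  by move=> cUV Vz Uz; exact: UnV cUV Uz Vz.
have x'x : ~` Vx' `<=` Ux.
  apply: (connected_side xS (conn _ _ _ xS') _ _ Uxp); first exact.
  exact: UnV xS' Ux'p.
have xm : ~` Vx `<=` Um.
  apply: (connected_side mS (conn _ _ _ xS) _ _ Ump); first exact.
  exact: UnV xS Uxp.
have ym : ~` Uy `<=` Vm.
  apply: (connected_side (cut_sidesC mS) (conn _ _ _ (cut_sidesC yS)) _ _ Vmq).
    exact.
  exact: VnU yS Vyq.
have y'y : ~` Uy' `<=` Vy.
  apply: (connected_side (cut_sidesC yS) (conn _ _ _ (cut_sidesC yS')) _ _ Vyq).
    exact.
  exact: VnU yS' Vy'q.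
have op c U V : @cut_sides X c U V -> open U by case.
have op' c U V : @cut_sides X c U V -> open V by case.
(* [s] is taken before [x'], [z] between [x] and [m], [w] between [m] and [y], and [t] after
   [y']. *)
have [s [Us Ss]] := dS Ux' (ex_intro _ p Ux'p) (op _ _ _ xS').
have [z [[Umz Vxz] Sz]] := dS (Um `&` Vx)
  (side_adherent X_connected mS Ump (op' _ _ _ xS) Vxm)
  (openI (op _ _ _ mS) (op' _ _ _ xS)).
have [w [[Vmw Uyw] Sw]] := dS (Vm `&` Uy)
  (side_adherent X_connected (cut_sidesC mS) Vmq (op _ _ _ yS) Uym)
  (openI (op' _ _ _ mS) (op _ _ _ yS)).
have [t [Vt St]] := dS Vy' (ex_intro _ q Vy'q) (op' _ _ _ yS').
exists s, z, w, t; split=> //; split.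
  exists m, Um, Vm; split=> //.
    exact/xm/(UnV _ _ _ _ xS)/x'x/(UnV _ _ _ _ xS').
  exact/ym/(VnU _ _ _ _ yS)/y'y/(VnU _ _ _ _ yS').
move=> c U V cUV Us' Uz Vw Vt'; split.
  (* If [c] were that close to [p], the complement of [Ux] would be a connected set that misses [c]
     and contains both [z] and [w], which lie on opposite sides of [c]. *)
  have nc : ~ (~` Vx') c.
    move=> /x'x Uxc; have := conn _ _ _ (cut_sidesC xS) => cn.
    have sub := connected_side cUV cn (fun h => h Uxc) (VnU _ _ _ _ xS Vxz) Uz.
    apply: (UnV _ _ _ w cUV _ Vw); apply: sub; apply: (VnU _ _ _ _ xS).
    by apply: contrapT => /xm; exact: VnU mS Vmw.
  apply: (connected_side cUV (conn _ _ _ xS') nc _ Us').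
    exact: UnV xS' Us.
  exact: UnV xS' Ux'p.
have nc : ~ (~` Uy') c.
  move=> /y'y Vyc; have := conn _ _ _ yS => cn.
  have sub := connected_side (cut_sidesC cUV) cn (fun h => h Vyc)
    (UnV _ _ _ _ yS Uyw) Vw.
  apply: (UnV _ _ _ z cUV Uz); apply: sub; apply: (UnV _ _ _ _ yS).
  by apply: contrapT => /ym; exact: UnV mS Umz.
apply: (connected_side (cut_sidesC cUV) (conn _ _ _ (cut_sidesC yS')) nc _ Vt').
  exact: VnU yS' Vt.
exact: VnU yS' Vy'q.
Qed.

(** For each quadruple from the dense set, choose one cut with the first two points on one side and
    the last two on the other, or a fixed cut if there is none. By [pinned_cut], any such choice
    separates the given [p] and [q]. *)
Lemma countable_cut_sides :
  separable_space X -> (exists x y : X, x <> y) ->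
  exists (c : nat -> X) (U V : nat -> set X),
    (forall n, cut_sides (c n) (U n) (V n)) /\
    forall p q, p <> q -> exists n, U n p /\ V n q.
Proof.
move=> [S cS dS] [x0 [y0 xy0]].
have [c0 [U0 [V0 [cUV0 _ _]]]] := dendritic_sides xy0.
have [|g [gS Sg]] := countable_enum cS.
  by have [s [_ Ss]] := dS setT (ex_intro _ x0 I) openT; exists s.
pose pins (i : nat * nat * (nat * nat)) (A : X * set X * set X) :=
  [/\ A.1.2 (g i.1.1), A.1.2 (g i.1.2), A.2 (g i.2.1) & A.2 (g i.2.2)].
have ex i : exists A : X * set X * set X, cut_sides A.1.1 A.1.2 A.2 /\
    ((exists c U V, cut_sides c U V /\ pins i (c, U, V)) -> pins i A).
  have [[c [U [V [cUV iA]]]]|nex] :=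
      pselect (exists c U V, cut_sides c U V /\ pins i (c, U, V)).
    by exists (c, U, V).
  by exists (c0, U0, V0); split=> // h; case: nex.
pose F n := projT1 (cid (ex (odflt ((0, 0), (0, 0))%N (unpickle n)))).
have FP n := projT2 (cid (ex (odflt ((0, 0), (0, 0))%N (unpickle n)))).
exists (fun n => (F n).1.1), (fun n => (F n).1.2), (fun n => (F n).2).
split=> [n|p q pq]; first by case: (FP n).
have [s [z [w [t [[Ss Sz Sw St] [[c [U [V [cUV Us Uz Vw Vt]]]] pin]]]]]] :=
  pinned_cut dS pq.
have [a ga] := Sg s Ss; have [b gb] := Sg z Sz.
have [d gd] := Sg w Sw; have [e ge] := Sg t St.
have := FP (pickle ((a, b), (d, e))); set n := pickle _; rewrite -/(F n).
rewrite pickleK /= => -[cF]; case.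
  by exists c, U, V; split=> //; split; rewrite /= ?ga ?gb ?gd ?ge.
rewrite /= ga gb gd ge => Fs Fz Fw Ft.
by exists n; apply: pin cF Fs Fz Fw Ft.
Qed.

End CountableSides.

Lemma finite_sides_convex (X : topologicalType) (c : nat -> X)
    (U V : nat -> set X) (s : seq nat) :
  (forall n, cut_sides (c n) (U n) (V n)) ->
  connected_trace [set z | forall k, k \in s -> ~ V k z].
Proof.
move=> cUV; elim: s => [|k s ih].
  by rewrite (_ : [set _ | _] = setT) => [C|]; [rewrite setIT|rewrite -subTset].
rewrite (_ : [set _ | _] = ~` V k `&` [set z | forall k, k \in s -> ~ V k z]).
  by apply: connected_traceI => //; exact: side_convex (cUV k).
apply/seteqP; split=> z /=.
  move=> h; split; first by apply: h; rewrite inE eqxx.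
  by move=> j js; apply: h; rewrite inE js orbT.
by move=> [Vk h] j; rewrite inE => /orP[/eqP->//|/h].
Qed.

(** Finitely many sides [V k] cover the compact boundary of a small neighbourhood [N] of [p]. The
    points outside all of them form a connected set that contains [p] and misses the boundary, so it
    stays in [N]. *)
Lemma sides_basis (X : topologicalType) (c : nat -> X) (U V : nat -> set X)
    (p : X) (W : set X) :
  connected [set: X] -> locally_compact [set: X] -> hausdorff_space X ->
  (forall n, cut_sides (c n) (U n) (V n)) ->
  (forall p q, p <> q -> exists n, U n p /\ V n q) ->
  open W -> W p ->
  exists s : seq nat, (forall k, k \in s -> U k p) /\
    forall z, ~ W z -> exists2 k, k \in s & V k z.
Proof.
move=> cX lX hX cUV sep oW Wp.
have [N [oN Op cN NW]] := locally_compact_shrink lX hX oW Wp.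
have cK : compact (closure N `&` ~` N).
  by apply: compact_closedI => //; exact: open_closedC.
have [s [sU sV]] : exists s : seq nat, (forall k, k \in s -> U k p) /\
    forall z, (closure N `&` ~` N) z -> exists2 k, k \in s & V k z.
  apply: (compact_ind (P := fun B => exists s : seq nat,
    (forall k, k \in s -> U k p) /\
    forall z, B z -> exists2 k, k \in s & V k z) cK).
  - by exists [::].
  - move=> A B [s [sU sA]] [t [tU tB]]; exists (s ++ t); split.
      by move=> k; rewrite mem_cat => /orP[/sU|/tU].
    move=> z [/sA|/tB] [k ks Vk]; exists k => //.
      by rewrite mem_cat ks.
    by rewrite mem_cat ks orbT.
  - by move=> A B AB [s [sU sB]]; exists s; split=> // z /AB/sB.
  - move=> x [_ nNx].
    have /sep[n [Unp Vnx]] : p <> x by move=> px; rewrite -px in nNx.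
    exists (V n); first by case: (cUV n) => _ oV _ _; exact: open_nbhs_nbhs.
    exists [:: n]; split=> [k|z Vz]; first by rewrite inE => /eqP->.
    by exists n => //; rewrite inE.
exists s; split=> // z nWz; apply: contrapT => /exists2P/forallNP nV.
have cA := finite_sides_convex (s := s) cUV cX; rewrite setTI in cA.
apply/nWz/NW/subset_closure.
have oC := closed_openC (@closed_closure _ N).
apply: (connected_subset_side cA oN oC _ _ _ Op).
- by move=> x _ /subset_closure cNx nNx; exact: nNx.
- move=> x Ax; have [cNx|] := pselect (closure N x); last by right.
  left; apply: contrapT => nNx; have [//|k ks Vk] := sV x.
  by apply: (Ax k).
- by move=> k /sU Ukp Vkp; have [_ _ UV _] := cUV k; exact: UV Ukp Vkp.
- by move=> k ks Vkz; apply: (nV k).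
Qed.

(** * The set of non-cut points *)

Lemma noncut_common_side (X : topologicalType) (c : nat -> X)
    (U V : nat -> set X) (y u v : X) :
  connected [set: X] ->
  (forall n, cut_sides (c n) (U n) (V n)) ->
  (forall p q, p <> q -> exists n, U n p /\ V n q) ->
  connected (~` [set y]) -> u <> y -> v <> y ->
  exists n, [/\ U n y, V n u & V n v].
Proof.
move=> cX cUV sep cY uy vy.
have UV n z : U n z -> V n z -> False.
  by have [_ _ + _] := cUV n => /[apply].
have oV n : open (V n) by case: (cUV n).
(* The complement of [V m] is connected and misses [c k], so it stays in [U k]. *)
have sub k m z : U k z -> ~ V m z -> V m (c k) -> V k `<=` V m.
  move=> Ukz Vmz Vmc x Vkx; apply: contrapT => nVmx; apply: (UV k x _ Vkx).
  exact: (connected_side (cUV k) (side_connected cX (cUV m)) _ Vmz Ukz).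
(* Two overlapping sides V k, V l that miss y lie in a common one. *)
have merge k l z' z : U k y -> U l y -> V k u -> V k z' -> V l z' -> V l z ->
    exists m, [/\ U m y, V m u & V m z].
  move=> Uky Uly Vku Vkz' Vlz' Vlz.
  have nV n : U n y -> ~ V n y := @UV n y.
  have [Vkc|nVkc] := pselect (V k (c l)).
    by exists k; split=> //; exact: (sub l k y Uly (nV _ Uky) Vkc).
  have [Vlc|nVlc] := pselect (V l (c k)).
    by exists l; split=> //; exact: (sub k l y Uky (nV _ Uly) Vlc).
  (* With a common cut point neither side need contain the other, but a side at a point between [y]
     and [c k] contains both. In the remaining case the two sides are disjoint. *)
  have [ckl|ckl] := pselect (c l = c k).
    have [|m [Umy Vmc]] := sep y (c k).
      by move=> yc; apply: (cut_sidesNl (cUV k)); rewrite -yc.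
    exists m; split=> //; first exact: (sub k m y Uky (nV _ Umy) Vmc).
    by apply: (sub l m y Uly (nV _ Umy)) => //; rewrite ckl.
  exfalso; apply: (UV k z') => //.
  have Ukc := cut_sidesE (cUV k) nVkc ckl.
  have Ulc := cut_sidesE (cUV l) nVlc (nesym ckl).
  have cl := side_connected cX (cut_sidesC (cUV l)).
  apply: (connected_side (cUV k) cl _ (cut_sidesNl (cUV l)) Ukc).
    by move=> nU; exact: nU.
  by move=> Ulz'; exact: UV Ulz' Vlz'.
(* By [merge], a side that misses [y] and meets [N] lies in [N] altogether, so [N] and [P] split the
   connected complement of [y]. *)
pose N := \bigcup_(n in [set n | U n y /\ V n u]) V n.
pose P := \bigcup_(n in [set n | U n y /\ forall z, V n z -> ~ N z]) V n.
have sub_N : ~` [set y] `<=` N.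
  have [n [Uny Vnu]] := sep y u (nesym uy).
  apply: (connected_subset_side (V := P) cY _ _ _ _ uy).
  - exact: bigcup_open.
  - exact: bigcup_open.
  - by move=> x _ Nx [m [_ Pm] Vmx]; exact: Pm Vmx Nx.
  - move=> x xy; have [l [Uly Vlx]] := sep y x (nesym xy).
    have [[z' [Vlz' [k [Uky Vku] Vkz']]]|/forallNP nN] :=
        pselect (exists z', V l z' /\ N z').
      left; have [m [Umy Vmu Vmx]] := merge k l z' x Uky Uly Vku Vkz' Vlz' Vlx.
      by exists m.
    by right; exists l => //; split=> // z Vlz Nz; apply: (nN z).
  - by exists n.
by have [n [Uny Vnu] Vnv] := sub_N v vy; exists n.
Qed.

Lemma noncut_points_le1 (X : topologicalType) :
  ~ (exists x y : X, x <> y) -> noncut_points X = [set: X].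
Proof.
move=> X1; rewrite -subTset => x _; apply.
suff -> : ~` [set x] = set0 by exact: connected0.
by rewrite -subset0 => y yx; apply: X1; exists y, x.
Qed.

Lemma noncut_points_Gdelta (X : topologicalType) :
  separable_space X -> hausdorff_space X -> dendritic X ->
  Gdelta (noncut_points X).
Proof.
move=> [S cS dS] hX dX; have [cX _] := dX.
have [X2|X1] := pselect (exists x y : X, x <> y); last first.
  by rewrite noncut_points_le1 //; apply: open_Gdelta; exact: openT.
have [c [U [V [cUV sep]]]] :=
  countable_cut_sides cX dX (ex_intro2 _ _ S cS dS) X2.
have [|g [gS Sg]] := countable_enum cS.
  have [x _] := X2.
  by have [s [_ Ss]] := dS setT (ex_intro _ x I) openT; exists s.
pose J i j := [set y | exists n, [/\ U n y, V n (g i) & V n (g j)]].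
(* The singleton of [g i] is the intersection of the open sets [E i k] over [k]. Distributing the
   union in [noncutE] over these intersections gives the four indices of [G]. *)
pose E i k := [set y | U k (g i) -> U k y].
have noncutE y : noncut_points X y <->
    forall i j, J i j y \/ y = g i \/ y = g j.
  split=> [/contrapT ncy i j|h /(cut_pointP _ hX)].
    have [|yi] := pselect (y = g i); first by right; left.
    have [|yj] := pselect (y = g j); first by right; right.
    by left; apply: (noncut_common_side cX cUV sep ncy); exact: nesym.
  move=> [A [B [cAB A0 B0]]]; have [oA oB AB cE] := cAB.
  have [s [As Ss]] := dS A A0 oA; have [t [Bt St]] := dS B B0 oB.
  have [i gi] := Sg s Ss; have [j gj] := Sg t St.
  have [[n [Uny]]|[yi|yj]] := h i j; rewrite ?gi ?gj.
  (* The complement of [U n] is connected, misses [y], and contains points of both sides [A] and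
     [B]. *)
  - move=> Vns Vnt; have con := side_connected cX (cut_sidesC (cUV n)).
    apply: (AB t) => //; have [_ _ UV _] := cUV n.
    apply: (connected_side cAB con _ _ As).
    + by move=> nU; exact: nU.
    + by move=> Uns; exact: UV Uns Vns.
    + by move=> Unt; exact: UV Unt Vnt.
  - by apply: (cut_sidesNl cAB); rewrite yi gi.
  - by apply: (cut_sidesNr cAB); rewrite yj gj.
have EP y i : (forall k, E i k y) -> y = g i.
  move=> Ey; apply: contrapT => /nesym/sep[k [Uk Vk]].
  by have [_ _ UV _] := cUV k; exact: UV (Ey k Uk) Vk.
pose G (i : nat * nat * (nat * nat)) :=
  J i.1.1 i.1.2 `|` (E i.1.1 i.2.1 `|` E i.1.2 i.2.2).
exists (fun n => G (odflt ((0, 0), (0, 0))%N (unpickle n))).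
  move=> n; case: (odflt _ _) => -[i j] [k l]; rewrite /G /=.
  have oU m : open (U m) by case: (cUV m).
  have oE a b : open (E a b).
    have [Uab|nUab] := pselect (U b (g a)).
      rewrite (_ : E a b = U b) //.
      by apply/seteqP; split=> y //=; [apply | move=> ? _].
    rewrite (_ : E a b = setT); first exact: openT.
    by rewrite -subTset => y _ /nUab.
  apply: openU; last exact: openU.
  rewrite (_ : J i j = \bigcup_(n in [set n | V n (g i) /\ V n (g j)]) U n).
    exact: bigcup_open.
  by apply/seteqP; split=> y [m]; [move=> [? ? ?]; exists m|
    move=> [? ?] ?; exists m].
apply/seteqP; split=> y.
  move=> /noncutE h n _; case: (odflt _ _) => -[i j] [k l]; rewrite /G /=.
  by have [|[->|->]] := h i j; [left|right; left|right; right].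
move=> h; apply/noncutE => i j.
have {}h k l : J i j y \/ E i k y \/ E j l y.
  by have := h (pickle ((i, j), (k, l))) I; rewrite pickleK.
have [|nJ] := pselect (J i j y); first by left.
have [Ei|/existsNP[k nEi]] := pselect (forall k, E i k y).
  by right; left; exact: EP.
right; right; apply: EP => l.
by have [//|[|]] := h k l.
Qed.

(** The open sets [G n] are dense in the interior [W], and a connected Hausdorff space with two
    points has no isolated point, so a Cantor scheme runs in [W]. In a one-point space the single
    point is non-cut and the conclusion fails. *)
Lemma noncut_points_nowhere_dense (R : realType) (X : topologicalType) :
  connected [set: X] -> locally_compact [set: X] -> hausdorff_space X ->
  Gdelta (noncut_points X) -> ~ ([set: R] #<= noncut_points X) ->
  (exists x y : X, x <> y) -> nowhere_dense (noncut_points X).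
Proof.
move=> cX lX hX [G oG NG] few [x0 [y0 xy0]].
have clos1 (x : X) : closed [set x].
  exact/accessible_closed_set1/hausdorff_accessible.
rewrite /nowhere_dense; set W := interior _.
apply: contrapT => /eqP/set0P W0.
apply: few; apply: card_le_trans (@card_real_le_bool_seq R) _.
apply: (@card_le_trans _ _ _ (W `&` \bigcap_n G n)); last first.
  by rewrite -NG; apply: subset_card_le => z [].
apply: cantor_scheme => //.
- exact: open_interior.
- move=> N oN [x Nx] _; apply: contrapT => N1.
  have N1x y : N y -> x = y.
    by move=> Ny; apply: contrapT => xy; apply: N1; exists x, y.
  have NT : [set: X] `<=` N.
    apply: (connected_subset_side (V := ~` [set x]) cX oN _ _ _ _ Nx) => //.
    - exact: closed_openC.
    - by move=> y _ /N1x <-; apply.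
    - by move=> y _; have [->|] := pselect (y = x); [left|right].
  by apply: xy0; rewrite -(N1x x0 (NT x0 I)) -(N1x y0 (NT y0 I)).
- move=> n N oN [x Nx] NW.
  have [z [ncz Nz]] : (noncut_points X `&` N) !=set0.
    by have /interior_subset := NW x Nx; apply; exact: open_nbhs_nbhs.
  by exists z; split=> //; move: ncz; rewrite NG; exact.
Qed.

(** * Compactification by countably many functions *)

Lemma metric_of_distance (R : realType) (T : choiceType) (d : T -> T -> R) :
  (forall x, d x x = 0) -> (forall x y, d x y = 0 -> x = y) ->
  (forall x y, d x y = d y x) -> (forall y x z, d x z <= d x y + d y z) ->
  exists (M : metricType R) (f : T -> M),
    [/\ injective f, range f = setT & forall x y, mdist (f x) (f y) = d x y].
Proof.
case: T d => T cT; set T' := Choice.Pack cT => d d0 dpos dsym dtri.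
pose m := isMetric.Build R T' d0 dpos dsym dtri.
pose M : metricType R := HB.pack T' m.
exists M, (fun x : T => (x : M)); split=> //.
by rewrite -subTset => x _; exists x.
Qed.

Lemma compact_embedding (S T : topologicalType) (f : S -> T) :
  compact [set: S] -> hausdorff_space T -> injective f -> continuous f ->
  topological_embedding f.
Proof.
move=> cS hT finj cf; split=> // U oU.
exists (~` (f @` (~` U))).
  apply: closed_openC; apply: compact_closed => //.
  apply: continuous_compact; first exact: continuous_subspaceT.
  by apply: (subclosed_compact _ cS) => //; exact: open_closedC.
apply/seteqP; split=> [_ [x Ux <-]|y [[x _ <-] nfx]].
  by split=> [|[z nUz /finj zx]]; [exists x|apply: nUz; rewrite zx].
by exists x => //; apply: contrapT => nUx; apply: nfx; exists x.
Qed.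

Section SeparatingFunctions.
Context {R : realType} {T : topologicalType} (H : nat -> T -> R).
Context (H_continuous : forall n, continuous (H n)).
Context (H_separates : forall x y, (forall n, H n x = H n y) -> x = y).

Lemma separating_hausdorff : hausdorff_space T.
Proof.
move=> p q pq; apply: H_separates => n; apply: (@Rhausdorff R) => A B Ap Bq.
have [||z [Az Bz]] := pq (H n @^-1` A) (H n @^-1` B); last by exists (H n z).
  exact: H_continuous.
exact: H_continuous.
Qed.

Context (H_bounded : forall n x, `|H n x| <= 1).

Let term x y n := `|H n x - H n y| / n.+1%:R.
(** A Hilbert cube metric: the weights tend to 0, so closeness in finitely many coordinates makes
    [dist] small. *)
Let dist x y := sup (range (term x y)).

Let term_le x y n : term x y n <= 2 / n.+1%:R.
Proof.
rewrite ler_pM2r ?invr_gt0 //; apply: le_trans (ler_normB _ _) _.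
by rewrite -[2%:R]/(1 + 1) lerD.
Qed.

Let term_ge0 x y n : 0 <= term x y n.
Proof. by rewrite divr_ge0. Qed.

Let term_le_dist x y n : term x y n <= dist x y.
Proof.
apply: ub_le_sup; last by exists n.
exists 2 => _ [m _ <-]; apply: le_trans (term_le _ _ _) _.
by rewrite ler_pdivrMr // ler_pMr // ler1n.
Qed.

Let dist_le x y c : (forall n, term x y n <= c) -> dist x y <= c.
Proof.
by move=> h; apply: ge_sup; [exists (term x y 0%N), 0%N|move=> _ [n _ <-]].
Qed.

Let dist_near x e : 0 < e -> \forall y \near x, dist x y < e.
Proof.
(* Beyond [N] the bound [2 / n.+1] on a term is at most [e / 2]. *)
move=> e0; pose N := Num.truncn (2 / (e / 2)).
have e20 : 0 < e / 2 by rewrite divr_gt0.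
have near_head m :
    \forall y \near x, forall n, (n < m)%N -> `|H n x - H n y| < e / 2.
  elim: m => [|m ih]; first by near=> y.
  have /cvgr_dist_lt/(_ _ e20) := @H_continuous m x.
  apply: filterS2 ih => y ih hm n; rewrite ltnS leq_eqVlt => /orP[/eqP->//|].
  exact: ih.
have := near_head N.+1; apply: filterS => y hy.
apply: (@le_lt_trans _ _ (e / 2)); last first.
  by rewrite ltr_pdivrMr // ltr_pMr // ltr1n.
apply: dist_le => n; have [nN|Nn] := ltnP n N.+1.
  apply: le_trans (ltW (hy n nN)).
  by rewrite ler_pdivrMr // ler_peMr // ler1n.
apply: le_trans (term_le _ _ _) _.
rewrite ler_pdivrMr // mulrC -ler_pdivrMr //.
apply: ltW; apply: lt_le_trans (truncnS_gt _) _.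
by rewrite ler_nat; apply: leq_trans Nn _.
Unshelve. all: by end_near. Qed.

(** By [dist_near] the identity to the metric space is continuous; from a compact space to a
    Hausdorff one it is a homeomorphism. *)
Lemma separating_metrizable : compact [set: T] -> metrizable R T.
Proof.
move=> cT.
have dist0 x : dist x x = 0.
  apply/eqP; rewrite eq_le; apply/andP; split.
    by apply: dist_le => n; rewrite /term subrr normr0 mul0r.
  exact: le_trans (term_ge0 x x 0%N) (term_le_dist x x 0%N).
have dist_pos x y : dist x y = 0 -> x = y.
  move=> dxy; apply: H_separates => n; apply/eqP; rewrite -subr_eq0 -normr_le0.
  have := term_le_dist x y n; rewrite dxy /term.
  by rewrite pmulr_lle0 // invr_gt0.
have dist_sym x y : dist x y = dist y x.
  rewrite /dist (_ : term x y = term y x) //.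
  by apply/funext => n; rewrite /term distrC.
have dist_tri y x z : dist x z <= dist x y + dist y z.
  apply: dist_le => n.
  apply: le_trans (lerD (term_le_dist x y n) (term_le_dist y z n)).
  by rewrite /term -mulrDl ler_pM2r ?invr_gt0 // ler_distD.
have [M [f [finj frange fd]]] :=
  metric_of_distance dist0 dist_pos dist_sym dist_tri.
exists M, f; split=> //; apply: compact_embedding => //.
  exact: metric_hausdorff.
move=> x U /nbhs_ballP[e /= e0]; rewrite ballEmdist => eU.
rewrite nbhs_filterE; have := dist_near x e0; apply: filterS => y xy.
by apply: eU; rewrite /= fd.
Qed.

End SeparatingFunctions.

(** [D] is the closure of the image of [X] in the cube of sequences in [-1, 1], and [H n] is the
    n-th coordinate. Injectivity of [e] is not claimed at this stage. *)
Lemma function_compactification (R : realType) (X : topologicalType)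
    (h : nat -> X -> R) :
  (forall n, continuous (h n)) -> (forall n x, `|h n x| <= 1) ->
  exists (D : topologicalType) (e : X -> D) (H : nat -> D -> R),
    [/\ compact [set: D], hausdorff_space D, metrizable R D &
        [/\ continuous e, closure (range e) = setT,
            (forall n, continuous (H n)), (forall n x, H n (e x) = h n x) &
            (forall x y, (forall n, H n x = H n y) -> x = y)]].
Proof.
move=> ch bh; pose P : topologicalType := {ptws nat -> R}.
pose e0 x : P := fun n => h n x.
pose A : set P := closure (range e0).
pose Q : set P := [set f | forall n, [set x : R | - 1 <= x <= 1] (f n)].
have cQ : compact Q.
  have := @segment_compact R (-1) 1; rewrite set_itvE => cI.
  exact: (@tychonoff nat (fun=> R) (fun=> [set x | -1 <= x <= 1]) (fun=> cI)).
have hP : hausdorff_space P.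
  by apply: (@hausdorff_product nat (fun=> R)) => _; exact: Rhausdorff.
have AQ : A `<=` Q.
  have /closure_id -> : closed Q by exact: compact_closed.
  by apply: closureS => _ [x _ <-] n; rewrite /= -ler_norml; exact: bh.
have cA : compact A.
  by apply: (subclosed_compact _ cQ AQ); exact: closed_closure.
pose D : topologicalType := A.
have Ae x : A (e0 x) by apply: subset_closure; exists x.
pose e x : D := exist _ (e0 x) (mem_set (Ae x)).
pose H n (d : D) : R := set_val d n.
have cval : continuous (set_val : D -> P) by exact: initial_continuous.
have cH n : continuous (H n).
  have cn : continuous ((fun f => f n) : P -> R).
    exact: (@proj_continuous nat (fun=> R) n).
  move=> d.
  exact: (@continuous_comp D P R set_val (fun f : P => f n) d (@cval d)
    (@cn _)).
have sepH x y : (forall n, H n x = H n y) -> x = y.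
  by move=> xy; apply: val_inj; apply/funext => n; exact: xy.
have bH n x : `|H n x| <= 1.
  have /AQ/(_ n) : A (set_val x) by exact: set_valP.
  by rewrite /= -ler_norml.
have nbhsD (d : D) (U : set D) : nbhs d U ->
    exists N : set P,
      [/\ open N, N (set_val d) & forall d', N (set_val d') -> U d'].
  by case=> ? [[N oN <-] Nd NU]; exists N; split=> // d' ?; exact: NU.
have cD : compact [set: D].
  move=> F FF _; have FA : (set_val @ F) A.
    rewrite /= nbhs_filterE.
    by apply: (@filterS _ F _ setT) => [x _|]; [exact: set_valP|exact: filterT].
  have [p [Ap clp]] := cA _ _ FA.
  exists (exist _ p (mem_set Ap)); split=> // B U FB /nbhsD[N [oN Np NU]].
  have [||_ [[b Bb <-] Nb]] := clp (set_val @` B) N.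
  - by rewrite /= nbhs_filterE; apply: filterS FB => b Bb; exists b.
  - exact: open_nbhs_nbhs.
  - by exists b; split=> //; exact: NU.
exists D, e, H; split=> //.
- exact: separating_hausdorff cH sepH.
- exact: separating_metrizable cH sepH bH cD.
- split=> //.
  + move=> x U /nbhsD[N [oN Ne NU]].
    have : continuous (e0 : X -> P).
      by move=> z; apply/pointwise_cvgP => n; exact: ch.
    move=> /(_ x N (open_nbhs_nbhs (conj oN Ne))) xN.
    by apply: (@filterS _ (nbhs x) _ (e0 @^-1` N)) => // z Nz; exact: NU.
  + rewrite -subTset => d _ U /nbhsD[N [oN Nd NU]].
    have [_ [[x _ <-] Nx]] : (range e0 `&` N) !=set0.
      have : A (set_val d) by exact: set_valP.
      by apply; exact: open_nbhs_nbhs.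
    by exists (e x); split; [exists x|exact: NU].
Qed.

(** * Dense connected subsets and signed bump functions *)

Lemma connected_between (T : topologicalType) (A B : set T) :
  connected A -> A `<=` B -> B `<=` closure A -> connected B.
Proof.
move=> cA AB BA E [x Ex] [C oC EC] [F cF EF].
have [y [Ay Cy]] : A `&` C !=set0.
  have [Bx Cx] : (B `&` C) x by rewrite -EC.
  by apply: (BA x Bx); exact: open_nbhs_nbhs.
have AF : A `<=` F.
  have AE : A `&` C = A `&` F.
    apply/seteqP; split=> z [Az hz]; split=> //.
      by have [] : (B `&` F) z by rewrite -EF EC; split=> //; exact: AB.
    by have [] : (B `&` C) z by rewrite -EC EF; split=> //; exact: AB.
  have <- : A `&` C = A; last by rewrite AE => z [].
  by apply: cA; [exists y|exists C|exists F].
rewrite EF; apply/setIidPl; apply: subset_trans BA _.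
by rewrite [X in _ `<=` X](closure_id F).1 //; exact: closureS.
Qed.

(** Take a bump function vanishing at [c] and change its sign on [U]. Continuity at [c] holds
    because the absolute value is the bump function itself. *)
Lemma signed_bump (R : realType) (X : topologicalType) (c : X)
    (U V W : set X) :
  locally_compact [set: X] -> hausdorff_space X -> cut_sides c U V ->
  open W -> W c ->
  exists h : X -> R, [/\ continuous h, (forall x, `|h x| <= 1),
    (forall x, h x < 0 -> U x), (forall x, 0 < h x -> V x) &
    (forall x, ~ W x -> (U x -> h x = - 1) /\ (V x -> h x = 1))].
Proof.
move=> lX hX cUV oW Wc.
have [f [cf f01 fc fW]] := @locally_compact_bump R X c W lX hX oW Wc.
have [oU oV UV cE] := cUV.
have f0 x : 0 <= f x by have /andP[] := f01 x.
pose h x := if pselect (U x) then - f x else f x.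
have hU x : U x -> h x = - f x by move=> Ux; rewrite /h; case: pselect.
have hN x : ~ U x -> h x = f x by move=> nUx; rewrite /h; case: pselect.
have hV x : V x -> h x = f x by move=> Vx; apply: hN => Ux; exact: UV Ux Vx.
have normh x : `|h x| = f x.
  by rewrite /h; case: pselect => ?; rewrite ?normrN ger0_norm.
exists h; split=> [x|x|x hx|x hx|x nWx].
- have [Ux|nUx] := pselect (U x).
    have hE : \forall y \near x, - f y = h y.
      have : nbhs x U by exact: open_nbhs_nbhs.
      by apply: filterS => y /hU.
    rewrite /continuous_at hU //; apply: cvg_trans (near_eq_cvg hE) _.
    by apply: cvgN; exact: cf.
  have [Vx|nVx] := pselect (V x).
    have hE : \forall y \near x, f y = h y.
      have : nbhs x V by exact: open_nbhs_nbhs.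
      by apply: filterS => y /hV.
    rewrite /continuous_at hV //; apply: cvg_trans (near_eq_cvg hE) _.
    exact: cf.
  have {nUx nVx}-> : x = c.
    by apply: contrapT => /cE[].
  have hc : h c = 0 by rewrite hN ?fc //; exact: cut_sidesNl cUV.
  rewrite /continuous_at hc; apply/cvgr0Pnorm_lt => e e0.
  have /cvgr0Pnorm_lt/(_ e e0) : f y @[y --> c] --> (0 : R).
    by rewrite -fc; exact: cf.
  by apply: filterS => y; rewrite normh ger0_norm.
- by rewrite normh; have /andP[] := f01 x.
- by apply: contrapT => /hN hE; move: hx; rewrite hE ltNge f0.
- apply: contrapT => nVx; have [xc|xc] := pselect (x = c).
    by move: hx; rewrite xc hN ?fc ?ltxx //; exact: cut_sidesNl cUV.
  by move: hx; rewrite hU ?oppr_gt0 ?ltNge ?f0 //; exact: cut_sidesE cUV _ _.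
- by split=> [/hU->|/hV->]; rewrite fW.
Qed.

(** * The dendrite containing X *)

Section Dendrite.
Context {R : realType} {X : topologicalType}.
Context (X_locally_compact : locally_compact [set: X])
  (X_hausdorff : hausdorff_space X) (X_dendritic : dendritic X).
Context (c : nat -> X) (U V : nat -> set X)
  (cUV : forall n, cut_sides (c n) (U n) (V n))
  (sep : forall p q, p <> q -> exists n, U n p /\ V n q).

Let X_connected : connected [set: X]. Proof. by case: X_dendritic. Qed.

Let UV n z : U n z -> V n z -> False.
Proof. by have [_ _ + _] := cUV n => /[apply]. Qed.

Lemma dendritic_bump_family : exists (W : nat -> nat -> set X)
    (h : nat -> nat -> X -> R),
  [/\ (forall k j, compact (closure (W k j))),
      (forall k x, x <> c k -> exists j, ~ W k j x),
      (forall k j, continuous (h k j)), (forall k j x, `|h k j x| <= 1) &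
  [/\ (forall k j x, h k j x < 0 -> U k x),
      (forall k j x, 0 < h k j x -> V k x) &
      (forall k j x, ~ W k j x ->
         (U k x -> h k j x = - 1) /\ (V k x -> h k j x = 1))]] /\
  (forall k j, W k j (c k)).
Proof.
have exK k : exists K, [/\ open K, K (c k) & compact (closure K)].
  have [K [oK Kc cK _]] :=
    locally_compact_shrink X_locally_compact X_hausdorff openT (I : setT (c k)).
  by exists K.
pose K k := projT1 (cid (exK k)); have KP k := projT2 (cid (exK k)).
(* The side [U j] constrains only if it contains [c k], so each [W k j] is a neighbourhood of [c k];
   over all [j] they shrink to that point. *)
pose W k j := K k `&` [set x | U j (c k) -> U j x].
have Wc k j : W k j (c k) by split=> //; case: (KP k).
have oW k j : open (W k j).
  apply: openI; first by case: (KP k).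
  have [Ujc|nUjc] := pselect (U j (c k)).
    rewrite (_ : [set _ | _] = U j); first by case: (cUV j).
    by apply/seteqP; split=> x //=; exact.
  rewrite (_ : [set _ | _] = setT); first exact: openT.
  by rewrite -subTset => x _ /nUjc.
have exh kj := signed_bump R X_locally_compact X_hausdorff (cUV kj.1)
  (oW kj.1 kj.2) (Wc kj.1 kj.2).
pose h k j := projT1 (cid (exh (k, j))).
have hP k j := projT2 (cid (exh (k, j))).
exists W, h; split=> //; split.
- move=> k j; have [_ _ cK] := KP k.
  apply: (subclosed_compact (@closed_closure _ _) cK).
  by apply: closureS => x [].
- move=> k x /nesym/sep[n [Unc Vnx]]; exists n => -[_ /(_ Unc) Unx].
  exact: UV Unx Vnx.
- by move=> k j; case: (hP k j).
- by move=> k j; case: (hP k j).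
- by split=> k j; case: (hP k j).
Qed.

Lemma dendritic_compactification : exists (D : topologicalType) (e : X -> D),
  [/\ dendrite R D, topological_embedding e & cut_points D = e @` cut_points X].
Proof.
have [W [h [[cW Wsep ch bh [hU hV hW]] Wc]]] := dendritic_bump_family.
pose dec n := odflt (0, 0)%N (unpickle n : option (nat * nat)).
have [D [e [H0 [cD hD mD [ce de cH0 H0e sepH0]]]]] :=
  function_compactification (h := fun n => h (dec n).1 (dec n).2)
    (fun n => ch _ _) (fun n => bh _ _).
pose H (k j : nat) := H0 (pickle (k, j)).
have cH k j : continuous (H k j) by exact: cH0.
have He k j x : H k j (e x) = h k j x by rewrite /H H0e /dec pickleK.
have clD (d : D) : closed [set d].
  exact/accessible_closed_set1/hausdorff_accessible.
have dense_e (d : D) (N : set D) : nbhs d N -> exists x, N (e x).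
  move=> dN; have [_ [[x _ <-] Nx]] : (range e `&` N) !=set0.
    by have : closure (range e) d by [rewrite de]; apply.
  by exists x.
(* Distinct codes of the same pair index functions that agree on the dense
   range of e, hence everywhere. *)
have sepH d d' : (forall k j, H k j d = H k j d') -> d = d'.
  move=> HH; apply: sepH0 => n.
  suff HE y : H0 n y = H (dec n).1 (dec n).2 y by rewrite !HE.
  apply: contrapT => /eqP; rewrite -subr_eq0 => Hy.
  pose g z := H0 n z - H (dec n).1 (dec n).2 z.
  have cg : continuous g by move=> z; apply: cvgB; [exact: cH0|exact: cH].
  have ygN : nbhs y (~` (g @^-1` [set 0])).
    apply: open_nbhs_nbhs; split; last by move=> /eqP; exact/negP.
    apply: closed_openC; apply: preimage_closed => [? _|]; first exact: cg.
    exact/accessible_closed_set1/hausdorff_accessible/Rhausdorff.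
  by have [x] := dense_e y _ ygN; apply; rewrite /g /= He H0e subrr.
have nbhs_lt0 k j (d : D) : H k j d < 0 -> \forall y \near d, H k j y < 0.
  move=> Hd; have oH : open (H k j @^-1` [set r | r < 0]).
    by apply: open_comp => [? _|]; [exact: cH|exact: open_lt].
  exact: (open_nbhs_nbhs (conj oH Hd)).
have nbhs_gt0 k j (d : D) : 0 < H k j d -> \forall y \near d, 0 < H k j y.
  move=> Hd; have oH : open (H k j @^-1` [set r | 0 < r]).
    by apply: open_comp => [? _|]; [exact: cH|exact: open_gt].
  exact: (open_nbhs_nbhs (conj oH Hd)).
have closureU k j (d : D) : H k j d < 0 -> closure (e @` U k) d.
  move=> /nbhs_lt0 Hd N dN; have [x [Hx Nx]] := dense_e d _ (filterI Hd dN).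
  by exists (e x); split=> //; exists x => //; apply: (hU k j); rewrite -He.
have closureV k j (d : D) : 0 < H k j d -> closure (e @` V k) d.
  move=> /nbhs_gt0 Hd N dN; have [x [Hx Nx]] := dense_e d _ (filterI Hd dN).
  by exists (e x); split=> //; exists x => //; apply: (hV k j); rewrite -He.
have closed_eK (A : set X) : compact (closure A) -> closed (e @` closure A).
  move=> cA; apply: compact_closed => //.
  by apply: continuous_compact => //; exact: continuous_subspaceT.
have einj : injective e.
  move=> x z exz; apply: contrapT => xz; have [k [Ux Vz]] := sep xz.
  have [|j nW] := Wsep k x.
    by move=> xc; apply: (cut_sidesNl (cUV k)); rewrite -xc.
  apply: (UV (n := k) (z := z)) => //; apply: (hU k j); rewrite -He -exz He.
  by rewrite (hW k j x nW).1 // ltrN10.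
have near_all (P : nat -> D -> Prop) (s : seq nat) (d : D) :
    (forall k, k \in s -> \forall y \near d, P k y) ->
    \forall y \near d, forall k, k \in s -> P k y.
  elim: s => [|k s ih] Ps; first by near=> y.
  have Pk : \forall y \near d, P k y by apply: Ps; rewrite inE eqxx.
  have : \forall y \near d, forall k, k \in s -> P k y.
    by apply: ih => j js; apply: Ps; rewrite inE js orbT.
  apply: filterS2 Pk => y Pky Psy j; rewrite inE => /orP[/eqP->//|].
  exact: Psy.
have emb : topological_embedding e.
  split=> // N oN.
  (* Near [e x], finitely many coordinates stay negative, which keeps points of [X] in the
     corresponding sides [U k] and hence in [N]. *)
  have loc x : N x -> \forall y \near e x, forall z, y = e z -> N z.
    move=> Nx; have [s [sU sV]] :=
      sides_basis X_connected X_locally_compact X_hausdorff cUV sep oN Nx.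
    have /(near_all (fun k y => exists j, H k j y < 0)) : forall k, k \in s ->
        \forall y \near e x, exists j, H k j y < 0.
      move=> k /sU Ux; have [|j nW] := Wsep k x.
        by move=> xc; apply: (cut_sidesNl (cUV k)); rewrite -xc.
      have : \forall y \near e x, H k j y < 0.
        by apply: nbhs_lt0; rewrite He (hW k j x nW).1 // ltrN10.
      by apply: filterS => y; exists j.
    apply: filterS => y hy z yz; apply: contrapT => /sV[k ks Vz].
    have [j] := hy k ks; rewrite yz He => /hU Uz; exact: UV Uz Vz.
  exists (interior [set y | forall z, y = e z -> N z]).
    exact: open_interior.
  apply/seteqP; split=> [_ [x Nx <-]|_ [[x _ <-] ix]].
    by split; [exists x|exact: loc].
  by exists x => //; exact: (interior_subset ix).
(* Otherwise points of [X] whose images approach [d] lie in [W k j], and the compact image of its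
   closure would contain [d]. *)
have extreme k j (d : D) : ~ range e d -> H k j d = 1 \/ H k j d = - 1.
  move=> nd; have [//|H1] := pselect (H k j d = 1); first by left.
  right; apply: contrapT => HN1; apply: nd.
  suff : closure (e @` closure (W k j)) d.
    have /closure_id <- := closed_eK _ (cW k j) => -[x _ <-].
    by exists x.
  move=> N dN.
  have o1 (r : R) : H k j d <> r -> \forall y \near d, H k j y <> r.
    move=> Hr; have oH : open (~` (H k j @^-1` [set r])).
      apply: closed_openC; apply: preimage_closed => [? _|]; first exact: cH.
      exact/accessible_closed_set1/hausdorff_accessible/Rhausdorff.
    exact: (open_nbhs_nbhs (conj oH Hr)).
  have [x [[h1 hN1] Nx]] :=
    dense_e d _ (filterI (filterI (o1 _ H1) (o1 _ HN1)) dN).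
  exists (e x); split=> //; exists x => //; apply: subset_closure.
  apply: contrapT => nWx; have [hWU hWV] := hW k j x nWx.
  have [_ _ _ /(_ x) cE] := cUV k.
  have [|/hWU|/hWV] := cE.1 _; rewrite -?He //.
  by move=> xc; apply: nWx; rewrite xc.
(* If [d] were on the negative side of every [k] in [s], points of [X] near [d] would lie in [N1],
   whose closure has a compact image missing [d]. The second index 0 is an arbitrary choice. *)
have escape (x : X) (d : D) : ~ range e d -> exists k,
    U k x /\ \forall y \near d, forall z, y = e z -> V k z.
  move=> nd; have [N1 [oN1 N1x cN1 _]] :=
    locally_compact_shrink X_locally_compact X_hausdorff openT (I : setT x).
  have [s [sU sV]] :=
    sides_basis X_connected X_locally_compact X_hausdorff cUV sep oN1 N1x.
  have [[k ks Hk]|nk] := pselect (exists2 k, k \in s & H k 0 d = 1).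
    exists k; split; first exact: sU.
    have : \forall y \near d, 0 < H k 0 y by apply: nbhs_gt0; rewrite Hk.
    by apply: filterS => y Hy z yz; apply: (hV k 0); rewrite -He -yz.
  exfalso; have neg : \forall y \near d, forall k, k \in s -> H k 0 y < 0.
    apply: near_all => k ks; apply: nbhs_lt0.
    have [Hk|->] := extreme k 0%N d nd; last by rewrite ltrN10.
    by case: nk; exists k.
  have out : \forall y \near d, ~ (e @` closure N1) y.
    apply: (@open_nbhs_nbhs _ _ (~` (e @` closure N1))); split.
      exact/closed_openC/closed_eK.
    by move=> [z _ ezd]; apply: nd; exists z.
  have [z [hz nNz]] := dense_e d _ (filterI neg out).
  have [|k ks Vz] := sV z.
    by move=> N1z; apply: nNz; exists z => //; exact: subset_closure.
  by have := hz k ks; rewrite He => /hU Uz; exact: UV Uz Vz.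
(* The closures of the two sides meet at most in [e x]. Off the range of [e], a connected set given
   by [escape] misses [x] and would meet both sides. *)
have alpha x A B d : cut_sides x A B -> closure (e @` A) d ->
    closure (e @` B) d -> d = e x.
  move=> cAB clA clB; apply: contrapT => dx.
  have [oA oB AB cE] := cAB.
  have [[z _ ezd]|nd] := pselect (range e d).
    have zx : z <> x by move=> zx; apply: dx; rewrite -ezd zx.
    have disj C C' : open C -> C z -> closure (e @` C') d ->
        exists2 y, C y & C' y.
      move=> oC Cz clC'; have [_ _ /(_ _ oC)[N oN CN]] := emb.
      have [_ Nez] : (range e `&` N) (e z) by rewrite -CN; exists z.
      have dN : nbhs d N by rewrite -ezd; exact: open_nbhs_nbhs.
      have [_ [[y C'y <-] Ney]] := clC' N dN.
      have : (range e `&` N) (e y) by split=> //; exists y.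
      by rewrite -CN => -[y' Cy' /einj yy']; exists y => //; rewrite -yy'.
    have [Az|Bz] := (cE z).1 zx.
      by have [y Ay By] := disj A B oA Az clB; exact: AB Ay By.
    by have [y By Ay] := disj B A oB Bz clA; exact: AB Ay By.
  have [k [Ukx near_V]] := escape x d nd.
  have [_ [[a Aa <-] /(_ a erefl) Vka]] := clA _ near_V.
  have [_ [[b Bb <-] /(_ b erefl) Vkb]] := clB _ near_V.
  have con := side_connected X_connected (cut_sidesC (cUV k)).
  apply: (AB b) => //; apply: (connected_side cAB con _ _ Aa).
  - by move=> nU; exact: nU.
  - by move=> Uka; exact: UV Uka Vka.
  - by move=> Ukb; exact: UV Ukb Vkb.
(* A cut of [X] extends to [D]: by density the closures of its sides cover all points but [e x], and
   by [alpha] their complements give disjoint open sides. *)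
have sepD x A B d d' : cut_sides x A B -> closure (e @` A) d ->
    closure (e @` B) d' -> d <> e x -> d' <> e x -> separates (e x) d d'.
  move=> cAB clA clB dx d'x; apply/separatesP.
  exists (~` closure (e @` B) `&` ~` [set e x]),
    (~` closure (e @` A) `&` ~` [set e x]).
  have cover y : y <> e x -> closure (e @` A) y \/ closure (e @` B) y.
    move=> yx; apply: contrapT => /not_orP[nA nB].
    have nx : nbhs y (~` (closure (e @` A) `|` closure (e @` B) `|` [set e x])).
      apply: open_nbhs_nbhs; split; last by move=> [[]|].
      apply: closed_openC; apply: closedU => //.
      by apply: closedU; exact: closed_closure.
    have [z nz] := dense_e y _ nx; apply: nz.
    have [->|zx] := pselect (z = x); first by right.
    have [_ _ _ /(_ z) cE] := cAB.
    left; have [Az|Bz] := cE.1 zx; [left|right]; apply: subset_closure.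
      by exists z.
    by exists z.
  split; first split.
  - by apply: openI; apply: closed_openC => //; exact: closed_closure.
  - by apply: openI; apply: closed_openC => //; exact: closed_closure.
  - by move=> y [nB yx] [nA _]; case: (cover y).
  - move=> y; split=> [yx|[[]|[]]] //.
    have [nB|/contrapT By] := pselect (~ closure (e @` B) y); first by left.
    by right; split=> // Ay; apply: yx; exact: alpha cAB Ay By.
  - by split=> // Bd; apply: dx; exact: alpha cAB clA Bd.
  - by split=> // Ad'; apply: d'x; exact: alpha cAB Ad' clB.
have e_neq x z A : A x -> ~ A z -> e x <> e z.
  by move=> Ax nAz /einj xz; rewrite xz in Ax.
have sep_in_out x d : ~ range e d -> exists y, separates y (e x) d.
  move=> nd; have [k [Ukx near_V]] := escape x d nd.
  exists (e (c k)); apply: (sepD _ _ _ _ _ (cUV k)).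
  - by apply: subset_closure; exists x.
  - move=> N dN; have [z [Vz Nz]] := dense_e d _ (filterI near_V dN).
    by exists (e z); split=> //; exists z => //; exact: Vz.
  - by apply: (e_neq _ _ (U k)) => //; exact: cut_sidesNl (cUV k).
  - by move=> dc; apply: nd; exists (c k).
have sepC (y a b : D) : separates y a b -> separates y b a.
  move=> /separatesP[A [B [cAB Aa Bb]]]; apply/separatesP.
  by exists B, A; split=> //; exact: cut_sidesC.
have dD : dendritic D.
  split.
    rewrite -de; apply: connected_closure.
    apply: connected_continuous_connected => //.
    exact: continuous_subspaceT.
  move=> d d' dd'.
  have [[x _ xd]|nd] := pselect (range e d); last first.
    have [[x' _ <-]|nd'] := pselect (range e d').
      by have [y /sepC] := sep_in_out x' d nd; exists y.
    have [k [j Hkj]] : exists k j, H k j d <> H k j d'.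
      apply: contrapT => nH; apply: dd'; apply: sepH => k j.
      by apply: contrapT => Hkj; apply: nH; exists k, j.
    have dc : d <> e (c k) by move=> dc; apply: nd; exists (c k).
    have d'c : d' <> e (c k) by move=> dc'; apply: nd'; exists (c k).
    exists (e (c k)).
    (* The two coordinates are 1 or -1 and differ, so [d] and [d'] lie on opposite sides of
       [e (c k)]. *)
    have [Hd|Hd] := extreme k j d nd; have [Hd'|Hd'] := extreme k j d' nd'.
    - by case: Hkj; rewrite Hd Hd'.
    - apply: sepC; apply: (sepD _ _ _ _ _ (cUV k)) => //.
        by apply: (closureU k j); rewrite Hd' ltrN10.
      by apply: (closureV k j); rewrite Hd.
    - apply: (sepD _ _ _ _ _ (cUV k)) => //.
        by apply: (closureU k j); rewrite Hd ltrN10.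
      by apply: (closureV k j); rewrite Hd'.
    - by case: Hkj; rewrite Hd Hd'.
  have [[x' _ xd']|nd'] := pselect (range e d'); last first.
    by rewrite -xd; exact: sep_in_out.
  have xx' : x <> x' by move=> xx'; apply: dd'; rewrite -xd -xd' xx'.
  have [_ /(_ x x' xx')[y /separatesP[A [B [cAB Ax Bx']]]]] := X_dendritic.
  exists (e y); rewrite -xd -xd'; apply: (sepD _ _ _ _ _ cAB).
  - by apply: subset_closure; exists x.
  - by apply: subset_closure; exists x'.
  - by apply: (e_neq _ _ A) => //; exact: cut_sidesNl cAB.
  - by apply: (e_neq _ _ B) => //; exact: cut_sidesNr cAB.
exists D, e; split=> //.
apply/seteqP; split=> [d cd|_ [x cx <-]].
  have [[x _ xd]|nd] := pselect (range e d); last first.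
    (* Removing a point outside the range leaves the dense connected range; below, removing [e x]
       for a non-cut [x] leaves the dense connected image of the rest of [X]. *)
    case: cd; apply: (@connected_between _ (range e)).
    - apply: connected_continuous_connected => //.
      exact: continuous_subspaceT.
    - by move=> _ [x _ <-] xd; apply: nd; exists x.
    - by rewrite de.
  exists x => // ncx; case: cd; rewrite -xd.
  apply: (@connected_between _ (e @` (~` [set x]))).
  - by apply: connected_continuous_connected => //; exact: continuous_subspaceT.
  - by move=> _ [z zx <-] /einj.
  - move=> y yx N yN.
    have yx' : nbhs y (~` [set e x]).
      by apply: open_nbhs_nbhs; split=> //; exact: closed_openC.
    have [z [zx Nz]] := dense_e y _ (filterI yx' yN).
    by exists (e z); split=> //; exists z => // zx'; apply: zx; rewrite zx'.
have [A [B [cAB [a Aa] [b Bb]]]] := (cut_pointP _ X_hausdorff).1 cx.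
have /separatesP[A' [B' [cAB' A'a B'b]]] : separates (e x) (e a) (e b).
  apply: (sepD _ _ _ _ _ cAB).
  - by apply: subset_closure; exists a.
  - by apply: subset_closure; exists b.
  - by apply: (e_neq _ _ A) => //; exact: cut_sidesNl cAB.
  - by apply: (e_neq _ _ B) => //; exact: cut_sidesNr cAB.
apply/(cut_pointP _ hD); exists A', B'.
by split=> //; [exists (e a)|exists (e b)].
Unshelve. all: by end_near. Qed.

End Dendrite.

(** * Spaces with at most one point, and the theorem *)

Lemma trivial_dendrite (R : realType) (X : topologicalType) :
  hausdorff_space X -> ~ (exists x y : X, x <> y) -> dendrite R X.
Proof.
move=> hX X1.
have eqX (x y : X) : x = y.
  by apply: contrapT => xy; apply: X1; exists x, y.
(* The empty space counts as connected here, so it is a case of its own. *)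
have X01 : [set: X] = set0 \/ exists x, [set: X] = [set x].
  have [/eqP|/set0P[x _]] := boolP ([set: X] == set0); first by left.
  by right; exists x; apply/seteqP; split=> y.
have cX : compact [set: X].
  by case: X01 => [->|[x ->]]; [exact: compact0|exact: compact_set1].
split; last first.
  apply: (separating_metrizable (H := fun _ _ => 0)) => // [n|n x].
    exact: cst_continuous.
  by rewrite normr0.
split=> //; split=> [|x y xy]; last by case: xy.
by case: X01 => [->|[x ->]]; [exact: connected0|exact: connected1].
Qed.

Theorem theorem1p1 (R : realType) (X : topologicalType)
    (X_connected : connected [set: X])
    (X_separable : separable_space X)
    (X_locally_compact : locally_compact [set: X])
    (X_hausdorff : hausdorff_space X)
    (X_noncut : card_lt (noncut_points X) [set: R]) :
  (exists (D : topologicalType) (e : X -> D),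
     [/\ dendrite R D, topological_embedding e &
         cut_points D = e @` cut_points X]) /\
  (((exists x y : X, x <> y) -> nowhere_dense (noncut_points X)) /\
   Gdelta (noncut_points X)).
Proof.
have [_ few] := X_noncut.
have dX : dendritic X by apply: few_noncut_dendritic few.
have GX := noncut_points_Gdelta X_separable X_hausdorff dX.
split; last first.
  by split=> // X2; exact: noncut_points_nowhere_dense GX few X2.
have [X2|X1] := pselect (exists x y : X, x <> y); last first.
  have dend := trivial_dendrite R X_hausdorff X1.
  exists X, id; split=> //; last by rewrite image_id.
  have [[_ cX _] _] := dend.
  by apply: compact_embedding cX X_hausdorff _ _ => x; [|exact: cvg_id].
have [c [U [V [cUV sep]]]] :=
  countable_cut_sides X_connected dX X_separable X2.
exact: dendritic_compactification cUV sep.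
Qed.
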